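(* Let $\Omega=[0,1]$ and let $\nu$ be the uniform (Lebesgue) measure on $[0,1]$. For no sequence $\{\Sigma'_n\}_{n\ge1}$ of solutions to the short-term optimal location problem is the Lebesgue measure $\mathcal{L}^1\llcorner[0,1]$ the weak$^*$ limit, as $n\to\infty$, of some subsequence of $\{\mu_{\Sigma'_n}\}$.
   Context: For a finite nonempty set $\Sigma\subset[0,1]$ put $F(\Sigma):=\int_0^1 \mathrm{dist}(x,\Sigma)\,dx$ and $\mu_\Sigma:=\frac{1}{\#\Sigma}\sum_{x\in\Sigma}\delta_x$, a Borel probability measure on $[0,1]$. A sequence of solutions to the short-term optimal location problem is a sequence $\{\Sigma'_n\}_{n\ge1}$ such that, with $\Sigma'_0:=\emptyset$, for each $n\ge1$ the set $\Sigma'_n$ minimizes $F$ among all nonempty sets $\Sigma$ with $\Sigma'_{n-1}\subset\Sigma\subset[0,1]$ and $\#\Sigma\le n$. Weak$^*$ convergence of measures on $[0,1]$ is convergence tested against continuous functions on $[0,1]$. *)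

(* Defs.v *)
From mathcomp Require Export all_boot all_order all_algebra finmap.
From mathcomp Require Export all_classical all_reals all_analysis.
Export Order.TTheory GRing.Theory Num.Theory.
Export numFieldNormedType.Exports.

Set Implicit Arguments.
Unset Strict Implicit.
Unset Printing Implicit Defensive.

Local Open Scope classical_set_scope.
Local Open Scope ring_scope.

(* [inf] takes the junk value 0 on the empty set, so this is a distance only
   for nonempty [Sigma]. *)
Definition dist (R : realType) (x : R) (Sigma : {fset R}) : R :=
  inf [set `|x - y| | y in [set` Sigma]].

Definition Fcost (R : realType) (Sigma : {fset R}) : R :=
  \int[lebesgue_measure]_(x in `[0, 1]) dist x Sigma.

Definition admissible (R : realType) (n : nat) (prev Sigma : {fset R}) : Prop :=
  [/\ Sigma != fset0,
      (prev `<=` Sigma)%fset,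
      [set` Sigma] `<=` `[0, 1] &
      (#|` Sigma| <= n)%N].

(* Only the values at [n >= 1] belong to the sequence of solutions;
   [Sig 0 = fset0] encodes the initial convention. *)
Definition short_term_solutions (R : realType) (Sig : nat -> {fset R}) : Prop :=
  Sig 0%N = fset0 /\
  forall n, admissible n.+1 (Sig n) (Sig n.+1) /\
    forall Sigma, admissible n.+1 (Sig n) Sigma -> Fcost (Sig n.+1) <= Fcost Sigma.

(* [Sigma] is enumerated without repetition by its underlying sequence, whose
   [i]-th item is [Sigma`_i]. *)
Definition mu (R : realType) (Sigma : {fset R}) :
    {measure set (measurableTypeR R) -> \bar R} :=
  mscale (#|` Sigma|%:R^-1)%:nng
    (msum (fun i => \d_(Sigma`_i : measurableTypeR R)) #|` Sigma|).

Lemma muE (R : realType) (Sigma : {fset R}) (A : set (measurableTypeR R)) :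
  mu Sigma A = ((#|` Sigma|%:R^-1)%:E *
    \sum_(x <- Sigma) \d_(x : measurableTypeR R) A)%E.
Proof.
by rewrite /mu /mscale /msum /= [in RHS](big_nth 0) big_mkord.
Qed.

Lemma mu_setT (R : realType) (Sigma : {fset R}) :
  Sigma != fset0 -> mu Sigma setT = 1%E.
Proof.
move=> S0; rewrite muE (eq_bigr (fun=> (1 : R)%:E)); last first.
  by move=> x _; rewrite diracT.
rewrite sumEFin -EFinM big_const_seq count_predT iter_addr_0 mulVf//.
by rewrite pnatr_eq0 cardfs_eq0.
Qed.

Definition lebesgue01 (R : realType) :
    {measure set (measurableTypeR R) -> \bar R} :=
  mrestr lebesgue_measure (measurable_itv `[(0 : R), 1]).

Definition weak_star_cvg01 (R : realType)
    (m : nat -> {measure set (measurableTypeR R) -> \bar R})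
    (l : {measure set (measurableTypeR R) -> \bar R}) : Prop :=
  forall f : R -> R, {within `[0, 1], continuous f} ->
    (fun k => \int[m k]_(x in `[0, 1]) f x) @ \oo -->
      \int[l]_(x in `[0, 1]) f x.

(* Main.v *)
(* Only the left half [0, 1/2] matters. Adding a point z lowers F by
   (z - x)(y - z)/2 inside a gap ]x, y[ and by (a - z)(a + 3z)/4 below the least
   point a. So a greedy step on the left either halves a longest gap of length L
   (gain L^2/8) or adds a/3 (gain a^2/3); the least point therefore runs through
   1/(2 3^j), and the block [1/(2 3^(j+1)), 1/(2 3^j)] is created as a single gap
   of length 3^-(j+1), which is later split dyadically. Since only longest gaps
   are halved, two gaps eventually differ by a factor at most 2. As
   3^j 2^k = 3^j' 2^k' forces j = j', two blocks cannot both contain gaps of two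
   different lengths, so among the blocks j = 0, 1, 2 at least two consist of
   equal gaps and contain a power of 2 of points each. Under convergence to the
   Lebesgue measure these numbers would be in a ratio close to 3 or 9. *)
Require Import Defs.
From mathcomp Require Import ring lra measurable_realfun.

Set Implicit Arguments.
Unset Strict Implicit.
Unset Printing Implicit Defensive.

Local Open Scope classical_set_scope.
Local Open Scope ring_scope.

(** * Distance to a finite set *)

Lemma fset_argmin (R : realType) (g : R -> R) (S : {fset R}) :
  S != fset0 -> exists2 q, q \in S & forall w, w \in S -> g q <= g w.
Proof.
case/fset0Pn => x xS; pose i0 : S := [` xS]%fset.
have [i _ imin] := @Order.TotalTheory.arg_minP _ R S i0 xpredT (g \o val) isT.
exists (val i); first exact: valP.
by move=> w wS; exact: (imin [` wS]%fset).
Qed.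

Lemma dist_nearest (R : realType) (S : {fset R}) (p q : R) : q \in S ->
  (forall w, w \in S -> `|p - q| <= `|p - w|) -> dist p S = `|p - q|.
Proof.
move=> qS qmin; rewrite /dist.
have lbq : lbound [set `|p - y| | y in [set` S]] `|p - q|.
  by move=> _ [w /= wS <-]; exact: qmin.
apply/eqP; rewrite eq_le; apply/andP; split.
  apply: ge_inf; first by exists `|p - q|.
  by exists q.
by apply: lb_le_inf => //; exists `|p - q|, q.
Qed.

Lemma dist_le (R : realType) (S : {fset R}) (p w : R) :
  w \in S -> dist p S <= `|p - w|.
Proof.
move=> wS; apply: ge_inf; last by exists w.
by exists 0 => _ [y _ <-].
Qed.

(** A point of [S] nearest to [q], tested at [p], costs at most |p - q| more, so the distance is
    1-Lipschitz. *)
Lemma dist_continuous (R : realType) (S : {fset R}) : S != fset0 ->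
  continuous (fun p : R => dist p S).
Proof.
move=> S0.
have lip (p q : R) : dist p S <= dist q S + `|p - q|.
  have [w wS wmin] := fset_argmin (fun w => `|q - w|) S0.
  rewrite (dist_nearest wS wmin).
  by have := dist_le p wS; have := ler_distD q p w; lra.
move=> p; apply/cvgrPdist_lt => e e0; near=> q.
have pq : `|p - q| < e by near: q; apply/nbhs_ballP; exists e.
have qp : `|q - p| < e by rewrite distrC.
rewrite ltr_norml; have := lip p q; have := lip q p; lra.
Unshelve. all: by end_near. Qed.

(** * Integrals over intervals *)

Lemma continuous_integrable (R : realType) (f : R -> R) (a b : R) :
  continuous f -> lebesgue_measure.-integrable `[a, b] (EFin \o f).
Proof.
move=> cf; apply: continuous_compact_integrable; first exact: segment_compact.
exact: continuous_subspaceT.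
Qed.

Lemma Rintegral_itv_split (R : realType) (f : R -> R) (a b c : R) :
  continuous f -> a <= b -> b <= c ->
  \int[lebesgue_measure]_(x in `[a, c]) f x =
  \int[lebesgue_measure]_(x in `[a, b]) f x +
  \int[lebesgue_measure]_(x in `[b, c]) f x.
Proof.
move=> cf ab bc.
rewrite -(@Rintegral_itv_obnd_cbnd _ b); last first.
  apply: (integrableS _ _ _ (continuous_integrable b c cf)) => //.
  by apply: subset_itvr; rewrite bnd_simp.
rewrite -(@Rintegral_itvB _ f (BLeft a) (BRight c) b) ?bnd_simp//.
  by rewrite addrC subrK.
exact: continuous_integrable.
Qed.

Lemma eq_Rintegral_itv (R : realType) (a b : R) (f g : R -> R) :
  (forall x, a <= x <= b -> f x = g x) ->
  \int[lebesgue_measure]_(x in `[a, b]) f x =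
  \int[lebesgue_measure]_(x in `[a, b]) g x.
Proof.
move=> fg; apply: eq_Rintegral => x; rewrite inE/= in_itv/=; exact: fg.
Qed.

(** The distance to a finite set is piecewise affine with slopes 1 and -1, so this formula evaluates
    every cost below. *)
Lemma Rintegral_affine (R : realType) (k m a b : R) : a <= b ->
  \int[lebesgue_measure]_(x in `[a, b]) (k * x + m) =
  k * (b ^+ 2 - a ^+ 2) / 2 + m * (b - a).
Proof.
rewrite le_eqVlt => /predU1P[->|ab].
  by rewrite set_itv1 Rintegral_set1; ring.
pose F (x : R) := k / 2 * x ^+ 2 + m * x.
have dF (x : R) : is_derive x 1 F (k * x + m).
  apply: is_derive_eq; rewrite /GRing.scale/=.
  by field.
have cF : continuous F.
  by move=> x; apply: differentiable_continuous; apply/derivable1_diffP; apply: ex_derive.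
have cf : continuous (fun x : R => k * x + m).
  move=> x; apply: continuousD; last exact: cst_continuous.
  by apply: continuousM; [exact: cst_continuous|exact: cvg_id].
rewrite /Rintegral (@continuous_FTC2 _ (fun x => k * x + m) F a b)//.
- by rewrite /= /F; field.
- exact: continuous_subspaceT.
- split; first by move=> x _; apply: ex_derive.
  + by apply: cvg_at_right_filter; exact: cF.
  + by apply: cvg_at_left_filter; exact: cF.
- by move=> x _; rewrite derive1E; apply: derive_val.
Qed.

(** * Gaps, and the change of the cost when a point is added *)

Definition gap (R : realType) (S : {fset R}) (x y : R) :=
  [/\ x \in S, y \in S, x < y & forall z, z \in S -> ~~ (x < z < y)].

(** The nearest point is [x] up to the midpoint and [y] after it: the integral is the area of a
    triangle with base y - x and height (y - x)/2. *)
Lemma Rintegral_dist_gap (R : realType) (S : {fset R}) (x y : R) : gap S x y ->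
  \int[lebesgue_measure]_(p in `[x, y]) dist p S = (y - x) ^+ 2 / 4.
Proof.
move=> [xS yS xy gapxy].
have far w : w \in S -> w <= x \/ y <= w.
  by move=> /gapxy; rewrite negb_and -!leNgt => /orP.
have S0 : S != fset0 by apply/fset0Pn; exists x.
rewrite (@Rintegral_itv_split _ _ x ((x + y) / 2) y); [|exact: dist_continuous|lra|lra].
rewrite (@eq_Rintegral_itv _ _ _ _ (fun p => 1 * p + - x)); last first.
  move=> p /andP[xp py].
  have -> : 1 * p + - x = `|p - x| by rewrite ger0_norm; lra.
  apply: dist_nearest => // w /far[]?; rewrite [X in X <= _]ger0_norm; try lra.
    by rewrite ger0_norm; lra.
  by rewrite ler0_norm; lra.
rewrite [X in _ + X](@eq_Rintegral_itv _ _ _ _ (fun p => (- 1) * p + y)); last first.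
  move=> p /andP[xp py].
  have -> : (- 1) * p + y = `|p - y| by rewrite ler0_norm; lra.
  apply: dist_nearest => // w /far[]?; rewrite [X in X <= _]ler0_norm; try lra.
    by rewrite ger0_norm; lra.
  by rewrite ler0_norm; lra.
rewrite !Rintegral_affine; [by field|lra|lra].
Qed.

Lemma Rintegral_dist_below (R : realType) (S : {fset R}) (a b : R) :
  b \in S -> (forall w, w \in S -> b <= w) -> a <= b ->
  \int[lebesgue_measure]_(p in `[a, b]) dist p S = (b - a) ^+ 2 / 2.
Proof.
move=> bS bmin ab.
rewrite (@eq_Rintegral_itv _ _ _ _ (fun p => (- 1) * p + b)); last first.
  move=> p /andP[ap pb].
  have -> : (- 1) * p + b = `|p - b| by rewrite ler0_norm; lra.
  apply: dist_nearest => // w /bmin ?; rewrite !ler0_norm; lra.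
by rewrite Rintegral_affine//; field.
Qed.

Lemma Rintegral_dist_above (R : realType) (S : {fset R}) (a b : R) :
  a \in S -> (forall w, w \in S -> w <= a) -> a <= b ->
  \int[lebesgue_measure]_(p in `[a, b]) dist p S = (b - a) ^+ 2 / 2.
Proof.
move=> aS amax ab.
rewrite (@eq_Rintegral_itv _ _ _ _ (fun p => 1 * p + - a)); last first.
  move=> p /andP[ap pb].
  have -> : 1 * p + - a = `|p - a| by rewrite ger0_norm; lra.
  apply: dist_nearest => // w /amax ?; rewrite !ger0_norm; lra.
by rewrite Rintegral_affine//; field.
Qed.

(** Localizes the effect of a new point: where some old point is at least as near, nothing
    changes. *)
Lemma dist_fset1U_far (R : realType) (S : {fset R}) (x z p : R) :
  x \in S -> `|p - x| <= `|p - z| -> dist p (z |` S)%fset = dist p S.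
Proof.
move=> xS pxz.
have [|q qS qmin] := @fset_argmin _ (fun w => `|p - w|) S.
  by apply/fset0Pn; exists x.
rewrite (dist_nearest qS qmin); apply: dist_nearest; first by rewrite !inE qS orbT.
by move=> w; rewrite !inE => /predU1P[->|/qmin//]; exact: le_trans (qmin x xS) pxz.
Qed.

Lemma gap_fset1U (R : realType) (S : {fset R}) (x y z : R) :
  gap S x y -> x < z < y -> gap (z |` S)%fset x z /\ gap (z |` S)%fset z y.
Proof.
move=> [xS yS xy gapxy] /andP[xz zy].
split; split; rewrite ?inE ?xS ?yS ?eqxx ?orbT// => w;
  rewrite !inE => /predU1P[->|/gapxy]; rewrite ?ltxx ?andbF//;
  apply: contra => /andP[? ?]; apply/andP; split; lra.
Qed.

(** With a, b the lengths of the two new gaps, (a + b)^2/4 is replaced by a^2/4 + b^2/4 on [x, y],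
    and the distance is unchanged elsewhere; the difference is ab/2. *)
Lemma Fcost_split_gap (R : realType) (S : {fset R}) (x y z : R) :
  [set` S] `<=` `[0, 1] -> gap S x y -> x < z < y ->
  Fcost (z |` S)%fset = Fcost S - (z - x) * (y - z) / 2.
Proof.
move=> S01 gxy xzy; have [xS yS xy _] := gxy; have /andP[xz zy] := xzy.
have [gxz gzy] := gap_fset1U gxy xzy.
have := S01 _ xS; have := S01 _ yS; rewrite /= !in_itv/= => /andP[y0 y1] /andP[x0 x1].
have split3 (T : {fset R}) : x \in T -> Fcost T =
    \int[lebesgue_measure]_(p in `[0, x]) dist p T +
    (\int[lebesgue_measure]_(p in `[x, y]) dist p T +
     \int[lebesgue_measure]_(p in `[y, 1]) dist p T).
  move=> xT; have T0 : T != fset0 by apply/fset0Pn; exists x.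
  have cT := dist_continuous T0.
  rewrite /Fcost (@Rintegral_itv_split _ _ 0 x 1)//.
  by rewrite (@Rintegral_itv_split _ _ x y 1)//; lra.
rewrite !split3//; last by rewrite !inE xS orbT.
rewrite (Rintegral_dist_gap gxy).
rewrite (@Rintegral_itv_split _ _ x z y); [|apply: dist_continuous|lra|lra]; last first.
  by apply/fset0Pn; exists x; rewrite !inE xS orbT.
rewrite (Rintegral_dist_gap gxz) (Rintegral_dist_gap gzy).
rewrite (@eq_Rintegral_itv _ 0 x _ (fun p => dist p S)); last first.
  move=> p /andP[p0 px]; apply: (dist_fset1U_far xS).
  rewrite !ler0_norm; lra.
rewrite (@eq_Rintegral_itv _ y 1 _ (fun p => dist p S)); last first.
  move=> p /andP[p0 px]; apply: (dist_fset1U_far yS).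
  rewrite !ger0_norm; lra.
by field.
Qed.

(** On [0, a] the value a^2/2 is replaced by z^2/2 for the new end piece plus (a - z)^2/4 for the
    new gap. *)
Lemma Fcost_add_below (R : realType) (S : {fset R}) (a z : R) :
  [set` S] `<=` `[0, 1] -> a \in S -> (forall w, w \in S -> a <= w) -> 0 <= z < a ->
  Fcost (z |` S)%fset = Fcost S - (a - z) * (a + 3 * z) / 4.
Proof.
move=> S01 aS amin /andP[z0 za].
have := S01 _ aS; rewrite /= in_itv/= => /andP[a0 a1].
have split2 (T : {fset R}) : a \in T -> Fcost T =
    \int[lebesgue_measure]_(p in `[0, a]) dist p T +
    \int[lebesgue_measure]_(p in `[a, 1]) dist p T.
  move=> aT; have T0 : T != fset0 by apply/fset0Pn; exists a.
  by rewrite /Fcost -Rintegral_itv_split//; exact: dist_continuous.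
have aU : a \in (z |` S)%fset by rewrite !inE aS orbT.
have gza : gap (z |` S)%fset z a.
  split; rewrite ?inE ?eqxx ?aS ?orbT// => w.
  by rewrite !inE => /predU1P[->|/amin]; rewrite ?ltxx// => aw; rewrite andbC ltNge aw.
rewrite !split2// (Rintegral_dist_below aS)//.
rewrite (@Rintegral_itv_split _ _ 0 z a); [|apply: dist_continuous|lra|lra]; last first.
  by apply/fset0Pn; exists a.
rewrite (Rintegral_dist_gap gza) (@Rintegral_dist_below _ _ 0 z)//; last 2 first.
- by rewrite !inE eqxx.
- by move=> w; rewrite !inE => /predU1P[->//|/amin]; lra.
rewrite (@eq_Rintegral_itv _ a 1 _ (fun p => dist p S)); last first.
  move=> p /andP[p0 px]; apply: (dist_fset1U_far aS).
  rewrite !ger0_norm; lra.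
by field.
Qed.

Lemma Fcost1 (R : realType) (z : R) : 0 <= z <= 1 ->
  Fcost [fset z]%fset = z ^+ 2 / 2 + (1 - z) ^+ 2 / 2.
Proof.
move=> /andP[z0 z1]; rewrite /Fcost (@Rintegral_itv_split _ _ 0 z 1)//; last first.
  by apply: dist_continuous; apply/fset0Pn; exists z; rewrite inE.
rewrite (@Rintegral_dist_below _ _ 0 z) ?(@Rintegral_dist_above _ _ z 1) ?inE//.
- by rewrite subr0.
- by move=> w; rewrite inE => /eqP->.
- by move=> w; rewrite inE => /eqP->.
Qed.

(** * Trapezoidal test functions: from weak* convergence to frequencies of points *)

(** Equal to 1 on [lo, hi], to 0 outside [lo - e, hi + e], and affine in between. Written with
    absolute values, it is visibly continuous, and its bounds follow from a case analysis on
    signs. *)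
Definition trapezoid (R : realType) (lo hi e x : R) : R :=
  (`|x - (lo - e)| - `|x - lo| - `|x - hi| + `|x - (hi + e)|) / (2 * e).

Lemma trapezoid_continuous (R : realType) (lo hi e : R) :
  continuous (trapezoid lo hi e).
Proof.
have cn (c : R) : continuous (fun x : R => `|x - c|).
  by move=> x; apply: cvg_norm; apply: cvgB; [exact: cvg_id|exact: cvg_cst].
move=> x; apply: cvgM; last exact: cvg_cst.
by apply: cvgD; [apply: cvgB; [apply: cvgB|]|]; exact: cn.
Qed.

Lemma trapezoid_ge0 (R : realType) (lo hi e x : R) : lo <= hi -> 0 < e ->
  0 <= trapezoid lo hi e x.
Proof.
move=> lohi e0; rewrite /trapezoid divr_ge0 ?mulr_ge0 ?(ltW e0)//.
have [?|?] := ler0P (x - (lo - e)); have [?|?] := ler0P (x - lo);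
have [?|?] := ler0P (x - hi); have [?|?] := ler0P (x - (hi + e)); lra.
Qed.

Lemma trapezoid_le1 (R : realType) (lo hi e x : R) : lo <= hi -> 0 < e ->
  trapezoid lo hi e x <= 1.
Proof.
move=> lohi e0; rewrite /trapezoid ler_pdivrMr; last lra.
have [?|?] := ler0P (x - (lo - e)); have [?|?] := ler0P (x - lo);
have [?|?] := ler0P (x - hi); have [?|?] := ler0P (x - (hi + e)); lra.
Qed.

Lemma trapezoid_eq1 (R : realType) (lo hi e x : R) : lo <= hi -> 0 < e ->
  lo <= x <= hi -> trapezoid lo hi e x = 1.
Proof.
move=> lohi e0 /andP[? ?]; rewrite /trapezoid (@ger0_norm _ (x - (lo - e))); last lra.
rewrite (@ger0_norm _ (x - lo)) ?(@ler0_norm _ (x - hi)); try lra.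
by rewrite ler0_norm; [field; lra|lra].
Qed.

Lemma trapezoid_eq0 (R : realType) (lo hi e x : R) : lo <= hi -> 0 < e ->
  ~~ (lo - e < x < hi + e) -> trapezoid lo hi e x = 0.
Proof.
move=> lohi e0; rewrite negb_and -!leNgt => /orP[] ?; rewrite /trapezoid; last first.
  by rewrite !ger0_norm; [ring|lra|lra|lra|lra].
by rewrite !ler0_norm; [ring|lra|lra|lra|lra].
Qed.

Lemma measurable_trapezoid (R : realType) (lo hi e : R) (D : set R) :
  measurable_fun D (EFin \o trapezoid lo hi e).
Proof.
apply/measurable_EFinP; apply: measurable_funTS.
by apply: continuous_measurable_fun; exact: trapezoid_continuous.
Qed.

Lemma Rintegral_mu_trapezoid (R : realType) (lo hi e : R) (S : {fset R}) :
  lo <= hi -> 0 < e -> [set` S] `<=` `[0, 1] ->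
  \int[mu S]_(x in `[0, 1]) trapezoid lo hi e x =
  (\sum_(x <- S) trapezoid lo hi e x) / #|` S|%:R.
Proof.
move=> lohi e0 S01; rewrite /Rintegral ge0_integral_mscale//=; last 2 first.
- exact: measurable_trapezoid.
- by move=> x _; rewrite lee_fin trapezoid_ge0.
rewrite ge0_integral_measure_sum//=; last 2 first.
- by move=> x _; rewrite lee_fin trapezoid_ge0.
- exact: measurable_trapezoid.
rewrite (eq_bigr (fun i : 'I_#|` S| => (trapezoid lo hi e S`_i)%:E)); last first.
  move=> i _; rewrite integral_dirac//; last exact: measurable_trapezoid.
  rewrite diracE mem_set ?mul1e//; apply: S01; exact: mem_nth.
by rewrite sumEFin -EFinM/= mulrC (big_nth 0) big_mkord.
Qed.

(** Comparison with the indicator of [lo - e, hi + e]. *)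
Lemma Rintegral_lebesgue01_trapezoid_le (R : realType) (lo hi e : R) :
  lo <= hi -> 0 < e ->
  \int[@lebesgue01 R]_(x in `[0, 1]) trapezoid lo hi e x <= hi - lo + 2 * e.
Proof.
move=> lohi e0; pose D : set (measurableTypeR R) := `[0, 1]%classic.
pose A : set (measurableTypeR R) := `[lo - e, hi + e]%classic.
have mD : measurable D by exact: measurable_itv.
have mA : measurable A by exact: measurable_itv.
have le : (\int[@lebesgue01 R]_(x in D) (trapezoid lo hi e x)%:E <=
    (hi - lo + 2 * e)%R%:E)%E.
  apply: (@le_trans _ _ (\int[@lebesgue01 R]_(x in D) (\1_A x)%:E)%E).
    apply: ge0_le_integral => //.
    - by move=> x _; rewrite lee_fin trapezoid_ge0.
    - exact: measurable_trapezoid.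
    - by apply/measurable_EFinP; exact: measurable_indic.
    - move=> x _; rewrite lee_fin indicE.
      have [_|] := boolP (x \in _); first exact: trapezoid_le1.
      rewrite notin_setE => xA; rewrite trapezoid_eq0//.
      apply/negP => /andP[? ?]; apply: xA; rewrite /A/= in_itv/=.
      by apply/andP; split; lra.
  rewrite integral_indic// /lebesgue01 /= /mrestr.
  apply: (@le_trans _ _ (lebesgue_measure (`[lo - e, hi + e] : set R))).
    apply: le_measure; rewrite ?inE//.
    - by apply: measurableI => //; exact: measurableI.
    - by apply: subset_trans (@subIsetl _ _ _) (@subIsetl _ _ _).
  rewrite lebesgue_measure_itv/= lte_fin ifT; last lra.
  by rewrite -EFinB lee_fin; lra.
rewrite -lee_fin /Rintegral fineK//.
rewrite ge0_fin_numE ?(le_lt_trans le (ltry _))//.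
by apply: integral_ge0 => x _; rewrite lee_fin trapezoid_ge0.
Qed.

(** Comparison with the indicator of [lo, hi], which lies in [0, 1]. *)
Lemma Rintegral_lebesgue01_trapezoid_ge (R : realType) (lo hi e : R) :
  lo <= hi -> 0 < e -> 0 <= lo -> hi <= 1 ->
  hi - lo <= \int[@lebesgue01 R]_(x in `[0, 1]) trapezoid lo hi e x.
Proof.
move=> lohi e0 lo0 hi1.
pose D : set (measurableTypeR R) := `[0, 1]%classic.
pose A : set (measurableTypeR R) := `[lo, hi]%classic.
have mD : measurable D by exact: measurable_itv.
have mA : measurable A by exact: measurable_itv.
(* The real-valued integral is 0 by convention when the extended one is infinite, so a lower bound
   requires finiteness first. *)
have fin : (\int[@lebesgue01 R]_(x in D) (trapezoid lo hi e x)%:E \is a fin_num)%E.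
  rewrite ge0_fin_numE; last first.
    by apply: integral_ge0 => x _; rewrite lee_fin trapezoid_ge0.
  apply: (@le_lt_trans _ _ (\int[@lebesgue01 R]_(x in D) (cst 1 x))%E).
    apply: ge0_le_integral => //.
    - by move=> x _; rewrite lee_fin trapezoid_ge0.
    - exact: measurable_trapezoid.
    - by move=> x _; rewrite lee_fin trapezoid_le1.
  rewrite integral_cst//= mul1e /lebesgue01/= /mrestr setIid.
  by rewrite lebesgue_measure_itv/= lte01 -EFinB ltry.
rewrite -lee_fin /Rintegral fineK//.
apply: (@le_trans _ _ (\int[@lebesgue01 R]_(x in D) (\1_A x)%:E)%E).
  rewrite integral_indic// /lebesgue01 /= /mrestr -setIA setIid setIidl; last first.
    by apply: subset_itvScc.
  rewrite lebesgue_measure_itv/= lte_fin; case: ltP => ?; first by rewrite -EFinB.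
  by rewrite lee_fin; lra.
apply: ge0_le_integral => //.
- by apply/measurable_EFinP; exact: measurable_indic.
- exact: measurable_trapezoid.
- move=> x _; rewrite lee_fin indicE.
  have [|_] := boolP (x \in _); last exact: trapezoid_ge0.
  by rewrite inE /A/= in_itv/= => ?; rewrite trapezoid_eq1.
Qed.


(** Half-open, so that an interval with both ends in [S] counts as many points as gaps. *)
Definition cnt (R : realType) (S : {fset R}) (lo hi : R) : nat :=
  count (fun x => lo < x <= hi) S.

(** The indicator of ]lo, hi] is squeezed between the trapezoid that is 1 on [lo + d, hi - d] and
    the one that is 1 on [lo, hi], both with slopes of width d. *)
Lemma weak_star_cvg01_cnt (R : realType) (T : nat -> {fset R}) (lo hi e : R) :
  (forall k, [set` T k] `<=` `[0, 1]) ->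
  weak_star_cvg01 (fun k => mu (T k)) (lebesgue01 R) ->
  0 <= lo -> lo < hi -> hi <= 1 -> 0 < e ->
  \forall k \near \oo,
    `|(cnt (T k) lo hi)%:R / #|` T k|%:R - (hi - lo)| < e.
Proof.
move=> T01 Tcvg lo0 lohi hi1 e0.
(* Each integral is within 2d of hi - lo and each limit costs another d, so the total error is at
   most 3d < e; the second bound keeps lo + d <= hi - d. *)
pose d := Num.min (e / 4) ((hi - lo) / 4).
have d0 : 0 < d by rewrite lt_min; apply/andP; split; lra.
have de : d <= e / 4 by rewrite ge_min lexx.
have dlh : d <= (hi - lo) / 4 by rewrite ge_min lexx orbT.
have cntE k : (cnt (T k) lo hi)%:R = \sum_(x <- T k) (lo < x <= hi)%R%:R :> R.
  by rewrite /cnt -sum1_count natr_sum big_mkcond/=; apply: eq_bigr => x _; case: ifP.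
have cdiv k (a b : R) : a <= b -> a / #|` T k|%:R <= b / #|` T k|%:R.
  by move=> ab; rewrite ler_wpM2r// invr_ge0.
have ctrap (l h : R) : {within `[0, 1], continuous (trapezoid l h d)}.
  by apply: continuous_subspaceT; exact: trapezoid_continuous.
have /cvgrPdist_lt/(_ d d0) := Tcvg _ (ctrap (lo + d) (hi - d)).
have /cvgrPdist_lt/(_ d d0) := Tcvg _ (ctrap lo hi).
apply: filterS2 => k; rewrite !Rintegral_mu_trapezoid//; try lra.
have := @Rintegral_lebesgue01_trapezoid_le R lo hi d (ltW lohi) d0.
have := @Rintegral_lebesgue01_trapezoid_ge R (lo + d) (hi - d) d.
set I1 := Rintegral _ _ _; set I2 := Rintegral _ _ _ => h1 h2.
have {}h1 : hi - d - (lo + d) <= I1 by apply: h1; lra.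
rewrite !ltr_norml => /andP[h3 h4] /andP[h5 h6].
have up : (cnt (T k) lo hi)%:R / #|` T k|%:R <=
    (\sum_(x <- T k) trapezoid lo hi d x) / #|` T k|%:R.
  apply: cdiv; rewrite cntE; apply: ler_sum => x _.
  have [/andP[? ?]|_] := boolP (lo < x <= hi); last by apply: trapezoid_ge0; lra.
  by rewrite trapezoid_eq1//; lra.
have low : (\sum_(x <- T k) trapezoid (lo + d) (hi - d) d x) / #|` T k|%:R <=
    (cnt (T k) lo hi)%:R / #|` T k|%:R.
  apply: cdiv; rewrite cntE; apply: ler_sum => x _.
  have [_|xN] := boolP (lo < x <= hi); first by apply: trapezoid_le1; lra.
  rewrite trapezoid_eq0//; first lra.
  by apply: contra xN => /andP[? ?]; apply/andP; split; lra.
apply/andP; split; lra.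
Qed.

(** * The invariant on the left half *)

Lemma gap_subset (R : realType) (S S' : {fset R}) (x y : R) :
  {subset S <= S'} -> x \in S -> y \in S -> gap S' x y -> gap S x y.
Proof. by move=> SS' xS yS [_ _ xy g]; split => // z /SS' /g. Qed.

(** Take the largest point of [S] below [z] and the smallest one above it; [a] and [b] show that
    both exist. *)
Lemma gap_around (R : realType) (S : {fset R}) (a b z : R) :
  a \in S -> b \in S -> a < z < b -> z \notin S ->
  exists x y, [/\ gap S x y, x < z < y & y <= b].
Proof.
move=> aS bS /andP[az zb] zS.
have [|x] := @fset_argmin _ (fun w => - w) [fset w in S | w < z]%fset.
  by apply/fset0Pn; exists a; rewrite !inE/= aS.
rewrite !inE/= => /andP[xS xz] xmax.
have [|y] := @fset_argmin _ id [fset w in S | z < w]%fset.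
  by apply/fset0Pn; exists b; rewrite !inE/= bS.
rewrite !inE/= => /andP[yS zy] ymin; exists x, y; split; last 2 first.
- by rewrite xz.
- by apply: ymin; rewrite !inE/= bS.
split => //; first exact: lt_trans zy.
move=> w wS; apply/negP => /andP[xw wy].
have [wz|zw|wz] := ltgtP w z; last by rewrite -wz wS in zS.
  by have := xmax w; rewrite !inE/= wS wz => /(_ isT); lra.
by have := ymin w; rewrite !inE/= wS zw => /(_ isT); lra.
Qed.

(** The successive values of the least point; two consecutive ones bound a block. *)
Definition epoint (R : realType) (j : nat) : R := (2 * 3 ^+ j)^-1.
Arguments epoint {R}.

Lemma epoint_gt0 (R : realType) j : 0 < epoint j :> R.
Proof. by rewrite invr_gt0 mulr_gt0 ?exprn_gt0. Qed.

Lemma epointS (R : realType) j : epoint j.+1 = epoint j / 3 :> R.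
Proof. by rewrite /epoint exprS; field; rewrite expf_neq0// pnatr_eq0. Qed.

Lemma epoint_le (R : realType) i j : (i <= j)%N -> epoint j <= epoint i :> R.
Proof.
move=> ij; rewrite lef_pV2 ?posrE ?mulr_gt0 ?exprn_gt0// ler_pM2l//.
by rewrite ler_eXn2l// ltr1n.
Qed.

Lemma epoint0 (R : realType) : epoint 0 = 1 / 2 :> R.
Proof. by rewrite /epoint; field. Qed.

(* [ls_coarse] makes [ls_balanced] vacuous when a new end gap appears to the
   right of 1/54 = epoint 3, i.e. while the least point is at least
   1/18 = epoint 2. *)
Record left_state (R : realType) (S : {fset R}) (i : nat) : Prop := LeftState {
  ls_epoint : forall j, (j <= i)%N -> epoint j \in S ;
  ls_min : forall w, w \in S -> epoint i <= w ;
  ls_dyadic : forall x y, gap S x y -> y <= 1 / 2 -> exists j k,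
    [/\ epoint j.+1 <= x, y <= epoint j & y - x = 2 * epoint j.+1 / 2 ^+ k] ;
  ls_coarse : 1 / 18 <= epoint i :> R ->
    forall x y, gap S x y -> y <= 1 / 2 -> 1 / 54 <= y - x ;
  ls_balanced : forall x y u v, gap S x y -> 1 / 54 < y <= 1 / 2 ->
    gap S u v -> 1 / 54 < v <= 1 / 2 -> y - x < 1 / 54 -> v - u <= 2 * (y - x) }.

Lemma fset1U_subset (R : realType) (S : {fset R}) (z : R) :
  {subset S <= (z |` S)%fset}.
Proof. by move=> w wS; rewrite !inE wS orbT. Qed.

(** A point to the right of 1/2 is not an end of any gap within the left half, so every clause is
    inherited. *)
Lemma left_state_above (R : realType) (S : {fset R}) (i : nat) (z : R) :
  left_state S i -> 1 / 2 < z -> left_state (z |` S)%fset i.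
Proof.
move=> Si z12; have subS := @fset1U_subset _ S z.
have gapS u v : gap (z |` S)%fset u v -> v <= 1 / 2 -> gap S u v.
  move=> g v12; have [uS vS uv _] := g.
  move: uS vS; rewrite !inE => /predU1P[uz|uS]; first lra.
  move=> /predU1P[vz|vS]; first lra.
  exact: gap_subset subS uS vS g.
split.
- by move=> j ji; apply: subS; exact: ls_epoint Si j ji.
- move=> w; rewrite !inE => /predU1P[->|/(ls_min Si)//].
  by have := epoint_le R (leq0n i); rewrite epoint0; lra.
- by move=> x y g y12; apply: (ls_dyadic Si (gapS _ _ g y12) y12).
- by move=> e18 x y g y12; apply: (ls_coarse Si e18 (gapS _ _ g y12) y12).
- move=> x y u v g1 /andP[y54 y12] g2 /andP[v54 v12].
  by apply: (ls_balanced Si (gapS _ _ g1 y12) _ (gapS _ _ g2 v12)); apply/andP.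
Qed.

(** The values 1/18 and 1/54 are consecutive. This leads from the side condition of [ls_balanced] to
    that of [ls_coarse]. *)
Lemma epoint_coarse (R : realType) i : 1 / 54 < epoint i :> R ->
  1 / 18 <= epoint i :> R.
Proof.
have e2 : epoint 2 = 1 / 18 :> R by rewrite /epoint; field.
have e3 : epoint 3 = 1 / 54 :> R by rewrite /epoint; field.
have [i2 _|i3] := leqP i 2; first by have := epoint_le R i2; lra.
by have := epoint_le R i3; lra.
Qed.

(** * Greedy steps preserve the invariant *)

(** Minimality among one-point enlargements, the form in which the short-term problem enters the
    comparison of gains. *)
Definition greedy (R : realType) (S : {fset R}) (z : R) :=
  forall t, 0 <= t <= 1 -> Fcost (z |` S)%fset <= Fcost (t |` S)%fset.

Lemma greedy_end (R : realType) (S : {fset R}) (i : nat) (z : R) :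
  left_state S i -> [set` S] `<=` `[0, 1] -> greedy S z ->
  Fcost (z |` S)%fset <= Fcost S - epoint i ^+ 2 / 3.
Proof.
move=> Si S01 Fmin; have e0 := epoint_gt0 R i.
have := epoint_le R (leq0n i); rewrite epoint0 => e12.
(* With a the least point, t = a/3 maximizes the gain (a - t)(a + 3t)/4, with value a^2/3. *)
apply: (@le_trans _ _ (Fcost (epoint i / 3 |` S)%fset)).
  by apply: Fmin; apply/andP; split; lra.
rewrite (@Fcost_add_below _ S (epoint i))//; last 3 first.
- exact: ls_epoint Si i (leqnn i).
- exact: ls_min Si.
- by apply/andP; split; lra.
by rewrite le_eqVlt; apply/orP; left; apply/eqP; field.
Qed.

Lemma greedy_gap (R : realType) (S : {fset R}) (z x y : R) :
  [set` S] `<=` `[0, 1] -> greedy S z -> gap S x y ->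
  Fcost (z |` S)%fset <= Fcost S - (y - x) ^+ 2 / 8.
Proof.
move=> S01 Fmin g; have [xS yS xy _] := g.
have := S01 _ xS; have := S01 _ yS; rewrite /= !in_itv/= => /andP[y0 y1] /andP[x0 x1].
apply: (@le_trans _ _ (Fcost ((x + y) / 2 |` S)%fset)).
  by apply: Fmin; apply/andP; split; lra.
rewrite (Fcost_split_gap S01 g); last by apply/andP; split; lra.
by rewrite le_eqVlt; apply/orP; left; apply/eqP; field.
Qed.

Lemma left_state_below (R : realType) (S : {fset R}) (i : nat) (z : R) :
  left_state S i -> [set` S] `<=` `[0, 1] -> greedy S z -> 0 <= z < epoint i ->
  left_state (z |` S)%fset i.+1.
Proof.
move=> Si S01 Fmin /andP[z0 zi]; have subS := @fset1U_subset _ S z.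
have eS := ls_epoint Si (leqnn i); have emin := ls_min Si.
have := greedy_end Si S01 Fmin.
rewrite (Fcost_add_below S01 eS)//; last by rewrite z0.
move=> gain.
have zE : z = epoint i / 3.
  (* For a = [epoint i], the inequality a^2/3 <= (a - z)(a + 3z)/4 rearranges to this one. *)
  have : (epoint i - 3 * z) ^+ 2 <= 0 by nra.
  rewrite real_exprn_even_le0//= ?num_real//; lra.
have zS1 : z = epoint i.+1 by rewrite epointS.
have e0 := epoint_gt0 R i; have := epoint_le R (leq0n i); rewrite epoint0 => e12.
have gapS u v : gap (z |` S)%fset u v -> gap S u v \/ u = z /\ v = epoint i.
  move=> g; have [uS vS uv gz] := g.
  move: uS vS; rewrite !inE => /predU1P[uz|uS].
    move=> /predU1P[vz|vS]; first lra.
    right; split => //; have := gz _ (subS _ eS); rewrite uz zi/= -leNgt.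
    by have := emin _ vS; lra.
  move=> /predU1P[vz|vS]; first by have := emin _ uS; lra.
  by left; exact: gap_subset subS uS vS g.
split.
- move=> j; rewrite leq_eqVlt => /predU1P[->|ji]; first by rewrite -zS1 !inE eqxx.
  by apply: subS; exact: ls_epoint Si j ji.
- by move=> w; rewrite -zS1 !inE => /predU1P[->//|/emin]; lra.
- move=> x y /gapS[g y12|[-> ->] _]; first exact: (ls_dyadic Si g y12).
  by exists i, 0%N; rewrite -zS1 expr0; split; lra.
- rewrite -zS1 => z18 x y /gapS[g y12|[-> ->] _]; last lra.
  by apply: (ls_coarse Si _ g y12); lra.
(* If the new gap takes part, its right end exceeds 1/54, so the least point was at least 1/18; then
   no gap involved is shorter than 1/54 and the claim is vacuous. *)
- move=> x y u v /gapS[g|[-> ->]] /andP[y54 y12]; last first.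
    by have := epoint_coarse y54; lra.
  move=> /gapS[g2|[-> ->]] /andP[v54 v12].
    by apply: (ls_balanced Si g _ g2); apply/andP.
  by have := ls_coarse Si (epoint_coarse v54) g y12; lra.
Qed.

(** Three competitors are used: the midpoint of the same gap forces [z] to be the midpoint,
    midpoints of other gaps show that the split gap is a longest one, and the end competitor bounds
    its length from below. *)
Lemma left_state_inside (R : realType) (S : {fset R}) (i : nat) (z x y : R) :
  left_state S i -> [set` S] `<=` `[0, 1] -> greedy S z ->
  gap S x y -> x < z < y -> y <= 1 / 2 -> left_state (z |` S)%fset i.
Proof.
move=> Si S01 Fmin gxy xzy y12; have subS := @fset1U_subset _ S z.
have eS := ls_epoint Si (leqnn i); have emin := ls_min Si.
have [xS yS xy gap0] := gxy; have /andP[xz zy] := xzy.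
have := greedy_end Si S01 Fmin.
have gain u v (g : gap S u v) := greedy_gap S01 Fmin g.
move: gain; rewrite (Fcost_split_gap S01 gxy xzy) => gain gain_end.
have zE : z = (x + y) / 2.
  have : (2 * z - x - y) ^+ 2 <= 0 by have := gain _ _ gxy; nra.
  rewrite real_exprn_even_le0//= ?num_real//; lra.
have {}gain u v : gap S u v -> v - u <= y - x.
  move=> g; have [_ _ uv _] := g; have := gain _ _ g; rewrite zE => ?.
  by rewrite leNgt; apply/negP => ?; nra.
have {}gain_end : epoint i ^+ 2 / 3 <= (y - x) ^+ 2 / 8.
  by move: gain_end; rewrite zE; lra.
have gapS u v : gap (z |` S)%fset u v ->
    gap S u v \/ v - u = (y - x) / 2 /\ x <= u /\ v <= y.
  move=> g; have [uS vS uv gz] := g.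
  have gx := gz _ (subS _ xS); have gy := gz _ (subS _ yS).
  move: uS vS gx gy; rewrite !inE => /predU1P[uz|uS].
    move=> /predU1P[vz|vS]; first lra.
    rewrite !negb_and -!leNgt => _ /orP[|] ?; first lra.
    by have := gap0 _ vS; rewrite negb_and -!leNgt => /orP[|] ?; right; lra.
  move=> /predU1P[vz|vS]; last by left; exact: gap_subset subS uS vS g.
  rewrite !negb_and -!leNgt => /orP[|] ? _; last lra.
  by have := gap0 _ uS; rewrite negb_and -!leNgt => /orP[|] ?; right; lra.
split.
- by move=> j ji; apply: subS; exact: ls_epoint Si j ji.
- by move=> w; rewrite !inE => /predU1P[->|/emin//]; have := emin _ xS; lra.
- move=> u v /gapS[g v12|[uvE [xu vy]] v12]; first exact: (ls_dyadic Si g v12).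
  have [j [k [? ? yxE]]] := ls_dyadic Si gxy y12.
  exists j, k.+1; split; try lra.
  by rewrite uvE yxE exprS; field; rewrite expf_neq0// pnatr_eq0.
- move=> e18 u v /gapS[g v12|[uvE _] _]; first exact: (ls_coarse Si e18 g v12).
  (* For L = y - x and a = [epoint i] >= 1/18, the bound L^2 >= 8a^2/3 gives L/2 > 1/54. *)
  by rewrite uvE; have := epoint_gt0 R i; rewrite leNgt => ?; apply/negP => ?; nra.
- move=> p q u v gpq /andP[q54 q12] guv /andP[v54 v12] small.
  have uvL : v - u <= y - x by case: (gapS _ _ guv) => [/gain//|]; lra.
  (* If ]p, q[ is a new half, twice its length is that of the split gap, which is a longest one. *)
  case: (gapS _ _ gpq) => [gpq'|]; last lra.
  case: (gapS _ _ guv) => [guv'|[uvE [? ?]]].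
    by apply: (ls_balanced Si gpq' _ guv') => //; apply/andP.
  (* Here ]u, v[ is a new half of ]x, y[, and the old balance for ]x, y[ is more than enough. *)
  suff : y - x <= 2 * (q - p) by lra.
  by apply: (ls_balanced Si gpq' _ gxy) => //; apply/andP; split => //; lra.
Qed.

Lemma left_state_step (R : realType) (S : {fset R}) (i : nat) (z : R) :
  left_state S i -> [set` S] `<=` `[0, 1] -> greedy S z -> z \notin S ->
  0 <= z -> exists i', left_state (z |` S)%fset i'.
Proof.
move=> Si S01 Fmin zS z0.
have hS : 1 / 2 \in S by rewrite -epoint0; exact: ls_epoint Si _ (leq0n i).
have [z12|z12|z12] := ltgtP z (1 / 2); last by rewrite z12 hS in zS.
  have [zi|zi|zi] := ltgtP z (epoint i).
  - by exists i.+1; apply: left_state_below => //; rewrite z0.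
  - exists i; have eS := ls_epoint Si (leqnn i).
    have [|x [y [g xzy y12]]] := gap_around eS hS _ zS; first by rewrite zi.
    exact: left_state_inside g xzy y12.
  - by rewrite zi (ls_epoint Si (leqnn i)) in zS.
by exists i; exact: left_state_above.
Qed.

Lemma left_state_init (R : realType) : left_state [fset 1 / 2 : R]%fset 0.
Proof.
have nogap (x y : R) : ~ gap [fset 1 / 2 : R]%fset x y.
  by case; rewrite !inE => /eqP-> /eqP->; rewrite ltxx.
split.
- by move=> j; rewrite leqn0 => /eqP->; rewrite epoint0 inE.
- by move=> w; rewrite inE epoint0 => /eqP->.
- by move=> x y /nogap.
- by move=> _ x y /nogap.
- by move=> x y u v /nogap.
Qed.

(** A third of the least point always lowers the cost strictly, so each step adds exactly one point;
    the step is then greedy and the invariant propagates. *)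
Lemma solutions_left_state (R : realType) (Sig : nat -> {fset R}) (n : nat) :
  short_term_solutions Sig ->
  #|` Sig n.+1| = n.+1 /\ exists i, left_state (Sig n.+1) i.
Proof.
move=> [Sig0 hS]; elim: n => [|n [cardn [i Si]]].
  have [[S0 _ S01 cS] Smin] := hS 0%N.
  have c1 : #|` Sig 1%N| = 1%N by apply/eqP; rewrite eqn_leq cS cardfs_gt0.
  split => //; exists 0%N.
  have /cardfs1P[z Sz] : #|` Sig 1%N| == 1%N by rewrite c1.
  have z01 : 0 <= z <= 1 by have := S01 z; rewrite Sz /= inE in_itv/= => /(_ (eqxx _)).
  suff zE : z = 1 / 2 by rewrite Sz zE; exact: left_state_init.
  have : Fcost (Sig 1%N) <= Fcost [fset 1 / 2 : R]%fset.
    apply: Smin; split.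
    - by apply/fset0Pn; exists (1 / 2); rewrite inE.
    - by rewrite Sig0 fsub0set.
    - by move=> w /=; rewrite inE in_itv/= => /eqP->; apply/andP; split; lra.
    - by rewrite cardfs1.
  rewrite Sz !Fcost1//; last by apply/andP; split; lra.
  (* Comparison with 1/2, whose cost is 1/4, forces the first point to be 1/2. *)
  move=> h; have : (2 * z - 1) ^+ 2 <= 0 by nra.
  by rewrite real_exprn_even_le0//= ?num_real//; lra.
have [[_ _ Sn01 _] _] := hS n.
have [[S0 sub S01 cS] Smin] := hS n.+1.
have adm (t : R) : 0 <= t <= 1 -> admissible n.+2 (Sig n.+1) (t |` Sig n.+1)%fset.
  move=> t01; split.
  - by apply/fset0Pn; exists t; rewrite !inE eqxx.
  - by apply/fsubsetP; exact: fset1U_subset.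
  - by move=> w /=; rewrite !inE => /predU1P[->|/Sn01]//; rewrite in_itv.
  - by rewrite cardfsU1 cardn -[n.+2]add1n leq_add2r leq_b1.
(* Otherwise adding [epoint i / 3] would be admissible and strictly cheaper. *)
have neq : Sig n.+2 != Sig n.+1.
  apply/eqP => SE; have e0 := epoint_gt0 R i.
  have := epoint_le R (leq0n i); rewrite epoint0 => e12.
  have eS := ls_epoint Si (leqnn i).
  have h01 : 0 <= (epoint i / 3 : R) <= 1 by apply/andP; split; lra.
  have := Smin _ (adm _ h01); rewrite SE.
  rewrite (@Fcost_add_below _ _ (epoint i))//; last 2 first.
  - exact: ls_min Si.
  - by apply/andP; split; lra.
  by nra.
have prop : (Sig n.+1 `<` Sig n.+2)%fset by rewrite fproperEneq eq_sym neq.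
have cardS : #|` Sig n.+2| = n.+2.
  by apply/eqP; rewrite eqn_leq cS/=; have := fproper_ltn_card prop; rewrite cardn.
split => //.
have /cardfs1P[z zE] : #|` (Sig n.+2 `\` Sig n.+1)%fset| == 1%N.
  by rewrite cardfsDS// cardS cardn subSnn.
have SE : Sig n.+2 = (z |` Sig n.+1)%fset.
  apply/fsetP => w; rewrite in_fset1U -in_fset1 -zE in_fsetD.
  by have [/(fsubsetP sub)->|_] := boolP (w \in Sig n.+1); rewrite ?orbF.
have : z \in (Sig n.+2 `\` Sig n.+1)%fset by rewrite zE inE.
rewrite inE => /andP[zS zS2].
rewrite SE; apply: (left_state_step Si) => //.
- by move=> t t01; rewrite -SE; apply: Smin; exact: adm.
- by have := S01 _ zS2; rewrite /= in_itv/= => /andP[].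
Qed.

(** * Counting points in an interval with equal gaps *)

Lemma cnt_split (R : realType) (S : {fset R}) (lo z hi : R) :
  hi \in S -> lo <= z < hi -> (forall w, w \in S -> ~~ (z < w < hi)) ->
  cnt S lo hi = (cnt S lo z).+1.
Proof.
move=> hS /andP[loz zhi] gzh; rewrite /cnt.
have -> : count (fun x => lo < x <= hi) S =
    count (predU (fun x => lo < x <= z) (pred1 hi)) S.
  apply: eq_in_count => w wS /=; have [->|whi] := eqVneq w hi.
    by rewrite orbT lexx (le_lt_trans loz).
  rewrite orbF; have := gzh _ wS; rewrite negb_and -!leNgt => hw.
  apply/andP/andP => -[? ?]; split => //; last lra.
  by have : w < hi; [rewrite lt_neqAle whi|case/orP: hw; lra].
have := count_predUI (fun x => lo < x <= z) (pred1 hi) S.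
rewrite (count_uniq_mem _ (fset_uniq S)) hS.
have -> : count (predI (fun x => lo < x <= z) (pred1 hi)) S = 0%N.
  rewrite -(count_pred0 S); apply: eq_count => w /=; apply/negP.
  by move=> /andP[/andP[_ wz] /eqP wh]; lra.
by rewrite addn0 addn1.
Qed.

(** Induction on the count, peeling off the last gap. *)
Lemma cnt_uniform (R : realType) (S : {fset R}) (s lo hi : R) :
  lo \in S -> hi \in S -> lo <= hi ->
  (forall x y, gap S x y -> lo <= x -> y <= hi -> y - x = s) ->
  (cnt S lo hi)%:R * s = hi - lo.
Proof.
move=> loS; have [n] := ubnP (cnt S lo hi); elim: n hi => // n IHn hi cn hS lohi gs.
have [->|lh] := eqVneq lo hi.
  rewrite subrr /cnt (eq_count (_ : _ =1 pred0)) ?count_pred0 ?mul0r// => w /=.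
  by apply/negP => /andP[]; lra.
have {lohi lh} lohi : lo < hi by rewrite lt_neqAle lh.
have [|z] := @fset_argmin _ (fun w => - w) [fset w in S | w < hi]%fset.
  by apply/fset0Pn; exists lo; rewrite !inE/= loS.
rewrite !inE/= => /andP[zS zhi] zmax.
have loz : lo <= z by have := zmax lo; rewrite !inE/= loS lohi => /(_ isT); lra.
have gzh w : w \in S -> ~~ (z < w < hi).
  move=> wS; apply/negP => /andP[zw wh].
  by have := zmax w; rewrite !inE/= wS wh => /(_ isT); lra.
have zhs : hi - z = s by apply: gs => //; split.
have cE : cnt S lo hi = (cnt S lo z).+1 by apply: cnt_split => //; rewrite loz.
have IH : (cnt S lo z)%:R * s = z - lo.
  apply: IHn => //; first by rewrite cE ltnS in cn.
  by move=> x y g lox yz; apply: gs => //; lra.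
by rewrite cE -natr1 mulrDl mul1r IH; lra.
Qed.

Lemma cnt_gt0 (R : realType) (S : {fset R}) (lo hi : R) :
  (0 < cnt S lo hi)%N -> exists2 w, w \in S & lo < w <= hi.
Proof. by rewrite -has_count => /hasP. Qed.

(** * Uniform and non-uniform blocks *)

(** Compare the 3-adic valuations. *)
Lemma dyadic_triadic_inj (k k' j j' : nat) :
  (3 ^ j * 2 ^ k = 3 ^ j' * 2 ^ k')%N -> j = j'.
Proof.
move=> E; have := congr1 (logn 3) E.
by rewrite !lognM ?expn_gt0// !lognX/= !muln0 !addn0 !muln1.
Qed.

(** The block has length 2 [epoint j.+1], so k is the common depth of dyadic splitting. *)
Definition uniform_block (R : realType) (S : {fset R}) (j : nat) :=
  exists k, forall x y, gap S x y -> epoint j.+1 <= x -> y <= epoint j ->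
    y - x = 2 * epoint j.+1 / 2 ^+ k.

(** The block provided by [ls_dyadic] must be block [j], since distinct blocks do not overlap. *)
Lemma block_dyadic (R : realType) (S : {fset R}) (i j : nat) (x y : R) :
  left_state S i ->
  gap S x y -> epoint j.+1 <= x -> y <= epoint j ->
  exists k, y - x = 2 * epoint j.+1 / 2 ^+ k.
Proof.
move=> Si g xj yj; have [_ _ xy _] := g.
have y12 : y <= 1 / 2 by have := epoint_le R (leq0n j); rewrite epoint0; lra.
have [j' [k [xj' yj' E]]] := ls_dyadic Si g y12.
have [jj'|jj'|->] := ltngtP j j'; last by exists k.
  by have := epoint_le R jj'; lra.
by have := epoint_le R jj'; lra.
Qed.

(** Blocks 0, 1, 2 lie in [1/54, 1/2], where [ls_balanced] applies to gaps shorter than 1/54. *)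
Lemma block_balanced (R : realType) (S : {fset R}) (i j j' : nat)
  (x y u v : R) :
  left_state S i -> (forall x y, gap S x y -> y <= 1 / 2 -> y - x < 1 / 54) ->
  (j < 3)%N -> (j' < 3)%N ->
  gap S x y -> epoint j.+1 <= x -> y <= epoint j ->
  gap S u v -> epoint j'.+1 <= u -> v <= epoint j' -> v - u <= 2 * (y - x).
Proof.
move=> Si fineS j3 j'3 g xj yj g' uj' vj'.
have e3 : epoint 3 = 1 / 54 :> R by rewrite /epoint; field.
have [_ _ xy _] := g; have [_ _ uv _] := g'.
have := epoint_le R (leq0n j); have := epoint_le R (leq0n j').
have := epoint_le R j3; have := epoint_le R j'3; rewrite e3 epoint0 => h1 h2 h3 h4.
have y12 : y <= 1 / 2 by lra.
apply: (ls_balanced Si g _ g' _ (fineS _ _ g y12)); apply/andP; split; lra.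
Qed.

(** By balance, two depths in one block differ by at most 1, so a block with several depths shows
    two consecutive ones. *)
Lemma not_uniform_block (R : realType) (S : {fset R}) (i j : nat) :
  left_state S i -> (forall x y, gap S x y -> y <= 1 / 2 -> y - x < 1 / 54) ->
  (j < 3)%N -> ~ uniform_block S j ->
  exists x y u v k, [/\ gap S x y, epoint j.+1 <= x, y <= epoint j &
    y - x = 2 * epoint j.+1 / 2 ^+ k] /\
    [/\ gap S u v, epoint j.+1 <= u, v <= epoint j &
    v - u = 2 * epoint j.+1 / 2 ^+ k.+1].
Proof.
move=> Si fineS j3 nU.
pose G k := exists x y, [/\ gap S x y, epoint j.+1 <= x, y <= epoint j &
    y - x = 2 * epoint j.+1 / 2 ^+ k].
suff [k [[x [y Gxy]] [u [v Guv]]]] : exists k, G k /\ G k.+1.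
  by exists x, y, u, v, k.
have Gle k k' : G k -> G k' -> (k < k')%N -> k' = k.+1.
  move=> [x [y [g1 x1 y1 E1]]] [u [v [g2 u2 v2 E2]]] kk'.
  have := block_balanced Si fineS j3 j3 g2 u2 v2 g1 x1 y1.
  rewrite E1 E2 => le2; apply/eqP; rewrite eqn_leq kk' andbT.
  have e0 := epoint_gt0 R j.+1.
  have : 2 ^+ k' <= 2 ^+ k.+1 :> R.
    have -> : 2 ^+ k.+1 = (2 * (2 ^+ k)) :> R by rewrite exprS.
    have k0 : 0 < 2 ^+ k :> R by rewrite exprn_gt0.
    have k'0 : 0 < 2 ^+ k' :> R by rewrite exprn_gt0.
    move: le2; rewrite ler_pdivrMr// [2 * (_ / _)]mulrA mulrAC ler_pdivlMr// => le2.
    have : (2 * epoint j.+1) * 2 ^+ k' <= (2 * epoint j.+1) * (2 * 2 ^+ k) :> R by lra.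
    by rewrite ler_pM2l//; lra.
  by rewrite ler_eXn2l// ltr1n.
apply: contrapT => nG; apply: nU.
have Guniq k k' : G k -> G k' -> k = k'.
  move=> Gk Gk'; have [kk|kk|//] := ltngtP k k'; exfalso; apply: nG.
    by exists k; split=> //; rewrite -(Gle _ _ Gk Gk' kk).
  by exists k'; split=> //; rewrite -(Gle _ _ Gk' Gk kk).
have [[k Gk]|nGk] := pselect (exists k, G k).
  exists k => x y g xj yj; have [k' E] := block_dyadic Si g xj yj.
  by rewrite (Guniq _ _ Gk (_ : G k'))//; exists x, y.
(* No gap lies in the block, so any depth will do. *)
exists 0%N => x y g xj yj; have [k' E] := block_dyadic Si g xj yj.
by exfalso; apply: nGk; exists k', x, y.
Qed.

(** Suppose the blocks contain gaps of lengths l, l/2 and l', l'/2. Balance gives l <= l' and l' <=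
    l; the equality l = l' then contradicts [dyadic_triadic_inj]. *)
Lemma uniform_block_or (R : realType) (S : {fset R}) (i j j' : nat) :
  left_state S i -> (forall x y, gap S x y -> y <= 1 / 2 -> y - x < 1 / 54) ->
  (j < 3)%N -> (j' < 3)%N -> j <> j' ->
  uniform_block S j \/ uniform_block S j'.
Proof.
move=> Si fineS j3 j'3 jj'; apply: contrapT => /not_orP[nU nU'].
have [x [y [u [v [k [[g1 x1 y1 E1] [g2 u2 v2 E2]]]]]]] :=
  not_uniform_block Si fineS j3 nU.
have [p [q [r [s [k' [[g3 p3 q3 E3] [g4 r4 s4 E4]]]]]]] :=
  not_uniform_block Si fineS j'3 nU'.
have le1 := block_balanced Si fineS j'3 j3 g4 r4 s4 g1 x1 y1.
have le2 := block_balanced Si fineS j3 j'3 g2 u2 v2 g3 p3 q3.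
have E : epoint j.+1 / 2 ^+ k = epoint j'.+1 / 2 ^+ k' :> R.
  have half m (a : R) : a / 2 ^+ m.+1 = a / 2 ^+ m / 2.
    by rewrite exprS; field; rewrite expf_neq0// pnatr_eq0.
  move: le1 le2; rewrite E1 E2 E3 E4 !half => le1 le2.
  by apply/eqP; rewrite eq_le; apply/andP; split; lra.
apply: jj'; suff : (3 ^ j.+1 * 2 ^ k = 3 ^ j'.+1 * 2 ^ k')%N.
  by move/dyadic_triadic_inj => [].
apply/eqP; rewrite -(eqr_nat R) !natrM !natrX; apply/eqP.
have nz (a m : nat) : (a.+1)%:R ^+ m != 0 :> R by rewrite expf_neq0// pnatr_eq0.
have cE a b : 3 ^+ a * 2 ^+ b = (2 * (epoint a / 2 ^+ b))^-1 :> R.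
  by rewrite /epoint; field; rewrite !nz.
by rewrite !cE E.
Qed.

Lemma cnt_uniform_block (R : realType) (S : {fset R}) (i j : nat) :
  left_state S i -> (j < i)%N -> uniform_block S j ->
  exists k, cnt S (epoint j.+1) (epoint j) = (2 ^ k)%N.
Proof.
move=> Si ji [k U]; exists k.
have e0 := epoint_gt0 R j.+1; have k0 : 0 < 2 ^+ k :> R by rewrite exprn_gt0.
have E : epoint j = 3 * epoint j.+1 :> R by rewrite epointS; field.
have := @cnt_uniform _ S _ _ _ (ls_epoint Si ji) (ls_epoint Si (ltnW ji)) _ U.
rewrite E => h.
have {h} h : (cnt S (epoint j.+1) (3 * epoint j.+1))%:R *
   (2 * epoint j.+1 / 2 ^+ k) = 3 * epoint j.+1 - epoint j.+1 :> R by apply: h; lra.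
apply/eqP; rewrite -(eqr_nat R) natrX; apply/eqP.
have nz : 2 * epoint j.+1 != 0 :> R by lra.
have E2 : 3 * epoint j.+1 - epoint j.+1 = 2 * epoint j.+1 :> R by ring.
apply: (mulIf nz); rewrite E2 in h.
by rewrite -{2}h; field; lra.
Qed.

(** * Contradiction with equidistribution *)

(** In exponents, m + k' < k < m + 1 + k' is impossible. The factor [r] will be 1/#S, which turns
    counts into frequencies. *)
Lemma ratio_not_pow2 (R : realType) (k k' m : nat) (r : R) : 0 <= r ->
  2 ^+ m * ((2 ^ k')%N%:R * r) < (2 ^ k)%N%:R * r ->
  (2 ^ k)%N%:R * r < 2 ^+ m.+1 * ((2 ^ k')%N%:R * r) -> False.
Proof.
rewrite le_eqVlt => /predU1P[<-|r0]; first by rewrite !mulr0 ltxx.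
rewrite !natrX !mulrA !ltr_pM2r// -!exprD !ltr_eXn2l ?ltr1n// => h.
by rewrite addSn ltnS leqNgt h.
Qed.

Lemma left_state_not_equidistributed (R : realType) (S : {fset R}) (i : nat) :
  left_state S i ->
  (forall c : 'I_200,
    `|(cnt S (c%:R / 200) (c.+1%:R / 200))%:R / #|` S|%:R
      - (c.+1%:R / 200 - c%:R / 200)| < 1 / 400 :> R) ->
  (forall j : 'I_3, `|(cnt S (epoint j.+1) (epoint j))%:R / #|` S|%:R
      - (epoint j - epoint j.+1)| < 1 / 2000 :> R) -> False.
Proof.
move=> Si grid blocks.
have e3 : epoint 3 = 1 / 54 :> R by rewrite /epoint; field.
have e2 : epoint 2 = 1 / 18 :> R by rewrite /epoint; field.
have e1 : epoint 1 = 1 / 6 :> R by rewrite /epoint; field.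
(* The tolerance 1/400 is smaller than the cell length 1/200, so no cell is empty. *)
have cell c : (c < 200)%N -> exists2 w : R, w \in S & c%:R < 200 * w <= c%:R + 1.
  move=> c200; have [|w wS /andP[cw wc]] := @cnt_gt0 R S (c%:R / 200) (c.+1%:R / 200).
    rewrite lt0n; apply/eqP => cnt0; have := grid (Ordinal c200).
    by rewrite /= cnt0 mul0r -natr1 ltr_norml => /andP[]; lra.
  by exists w => //; move: wc; rewrite -natr1 => wc; apply/andP; split; lra.
(* The first cell contains a point at most 1/200, hence below 1/18. *)
have i3 : (3 <= i)%N.
  rewrite leqNgt; apply/negP; rewrite ltnS => /(epoint_le R); rewrite e2 => ei.
  by have [//|w /(ls_min Si)] := cell 0%N; lra.
have fineS x y : gap S x y -> y <= 1 / 2 -> y - x < 1 / 54.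
  move=> g y12; have [xS yS xy gw] := g; rewrite ltNge; apply/negP => yx.
  have x0 : 0 <= x by have := ls_min Si xS; have := epoint_gt0 R i; lra.
  have x200 : 0 <= 200 * x by lra.
  (* As 1/54 > 3/200, the cell after the one containing [x] would lie inside the gap, yet it
     contains a point of [S]. *)
  have /andP[cx xc] := truncn_itv x200.
  set c := Num.truncn (200 * x) in cx xc; rewrite -natr1 in xc.
  have c200 : (c.+1 < 200)%N by rewrite -(ltr_nat R) -natr1; lra.
  have [w wS] := cell c.+1 c200; rewrite -natr1 => /andP[cw wc].
  by have /negP[] := gw _ wS; apply/andP; split; lra.
have r0 : 0 <= #|` S|%:R^-1 :> R by rewrite invr_ge0.
have pair (j j' : 'I_3) : (j < j')%N -> uniform_block S j -> uniform_block S j' -> False.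
  move=> jj' /(cnt_uniform_block Si (leq_trans (ltn_ord j) i3))[k Ek].
  move=> /(cnt_uniform_block Si (leq_trans (ltn_ord j') i3))[k' Ek'].
  have := blocks j'; have := blocks j; rewrite Ek Ek' !ltr_norml.
  move: j j' jj' {Ek Ek'} => [[|[|[|//]]] ?] [[|[|[|//]]] ?]//= _;
    rewrite ?epoint0 ?e1 ?e2 ?e3 => /andP[? ?] /andP[? ?].
  (* The block lengths are 1/3, 1/9, 1/27. A ratio near 3 lies between 2 and 4, one near 9 between 8
     and 16; the tolerance 1/2000 keeps it there. *)
  - by apply: (@ratio_not_pow2 R k k' 1 _ r0); rewrite ?exprS ?expr0; lra.
  - by apply: (@ratio_not_pow2 R k k' 3 _ r0); rewrite ?exprS ?expr0; lra.
  - by apply: (@ratio_not_pow2 R k k' 1 _ r0); rewrite ?exprS ?expr0; lra.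
pose o0 : 'I_3 := @Ordinal 3 0 isT; pose o1 : 'I_3 := @Ordinal 3 1 isT.
pose o2 : 'I_3 := @Ordinal 3 2 isT.
(* At most one of the three blocks is not uniform, which leaves a uniform pair. *)
have u01 := @uniform_block_or R S i 0 1 Si fineS isT isT.
have u02 := @uniform_block_or R S i 0 2 Si fineS isT isT.
have u12 := @uniform_block_or R S i 1 2 Si fineS isT isT.
have [//|U0|U1] := u01.
  have [//|U1|U2] := u12; first exact: (pair o0 o1).
  exact: (pair o0 o2).
have [//|U0|U2] := u02; first exact: (pair o0 o1).
exact: (pair o1 o2).
Qed.

Theorem theorem4p10 (R : realType) (Sig : nat -> {fset R})
  (hS : short_term_solutions Sig) :
  ~ exists phi : nat -> nat,
      [/\ forall k, (0 < phi k)%N,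
          {homo phi : i j / (i < j)%N} &
          weak_star_cvg01 (fun k => mu (Sig (phi k))) (lebesgue01 R)].
Proof.
move=> [phi [phi_gt0 _ cvg]].
have T01 k : [set` Sig (phi k)] `<=` `[0, 1].
  by have [[_ _ S01 _] _] := hS.2 (phi k).-1; rewrite prednK in S01.
have grid : \forall k \near \oo, forall c : 'I_200,
    `|(cnt (Sig (phi k)) (c%:R / 200) (c.+1%:R / 200))%:R / #|` Sig (phi k)|%:R
      - (c.+1%:R / 200 - c%:R / 200)| < 1 / 400 :> R.
  apply: filter_forall => c.
  have c0 : 0 <= c%:R :> R by [].
  have c200 : c%:R + 1 <= 200 :> R by rewrite natr1 ler_nat.
  have cS : c.+1%:R = c%:R + 1 :> R by rewrite natr1.
  by apply: (weak_star_cvg01_cnt T01 cvg); rewrite ?cS; lra.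
have blocks : \forall k \near \oo, forall j : 'I_3,
    `|(cnt (Sig (phi k)) (epoint j.+1) (epoint j))%:R / #|` Sig (phi k)|%:R
      - (epoint j - epoint j.+1)| < 1 / 2000 :> R.
  apply: filter_forall => j; have e0 := epoint_gt0 R j.
  have := epoint_le R (leq0n j); rewrite epoint0 => e12.
  by apply: (weak_star_cvg01_cnt T01 cvg); rewrite ?epointS; lra.
(* Finitely many frequency estimates hold together for large k, and one such k is enough. *)
have [k [gk bk]] := filter_ex (filterI grid blocks).
have [_ [i Si]] := solutions_left_state (phi k).-1 hS.
rewrite prednK// in Si.
exact: left_state_not_equidistributed Si gk bk.
Qed.
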